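(* Let $\mathcal{I}$ be an ideal on $\omega$. Then the following statements are equivalent: (a) $\mathcal{I}$ is Ramsey. (b) $\mathcal{I}$ is $\textrm{h-Mon}_n$ for all $n\geq 1$.
   Context: An ideal on $\omega$ is a family $\mathcal{I}\subseteq\wp(\omega)$ containing all finite sets, with $\omega\notin\mathcal{I}$, closed under subsets and finite unions. $\mathcal{I}^+$ is the family of infinite subsets of $\omega$ not in $\mathcal{I}$. $[A]^n$ is the family of subsets of $A$ of size $n$. $\mathcal{I}$ is Ramsey if for every $A\in\mathcal{I}^+$ and every $\pi:[A]^2\to 2$ there is $H\in\mathcal{I}^+$, $H\subseteq A$, such that $\pi$ is constant on $[H]^2$. The shift relation on finite subsets of $\omega$: $s\triangleleft t$ iff $s\setminus\{\min s\}$ is an initial segment of $t$ (possibly equal to $t$). For $n\geq1$ and infinite $A\subseteq\omega$, the relation $\triangleleft$ is used restricted to $[A]^n$, where $s\triangleleft t$ means that $t$ is obtained from $s$ by removing the first element of $s$ and adding a new element above $\max s$. On $[A]^n$, $\triangleleft^*$ is the transitive closure of this relation: $s\triangleleft^* t$ iff there are $k\geq 1$ and $r_0,\dots,r_k\in[A]^n$ with $s=r_0\triangleleft r_1\triangleleft\cdots\triangleleft r_k=t$. (For $n=1$ this is the usual strict order of $\omega$.) A function $f:[A]^n\to\mathbb{R}$ is monotone if either for all $s,t\in[A]^n$, $s\triangleleft^*t$ implies $f(s)\leq f(t)$, or for all $s,t\in[A]^n$, $s\triangleleft^*t$ implies $f(s)\geq f(t)$. $\mathcal{I}$ is $\textrm{h-Mon}_n$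 if for every $A\in\mathcal{I}^+$ and every $f:[A]^n\to\mathbb{R}$ there is $B\in\mathcal{I}^+$, $B\subseteq A$, such that $f\restriction[B]^n$ is monotone. *)

(* Defs.v *)
From Stdlib Require Import Relation_Operators.
From mathcomp Require Import all_boot all_order all_algebra.
From mathcomp Require Import finmap.
From mathcomp Require Import all_classical all_reals.
Set Implicit Arguments.
Unset Strict Implicit.
Unset Printing Implicit Defensive.
Local Open Scope classical_set_scope.
Local Open Scope ring_scope.

Definition is_ideal (I : set (set nat)) : Prop :=
  [/\ forall A, finite_set A -> I A,
      ~ I setT,
      forall A B, A `<=` B -> I B -> I A &
      forall A B, I A -> I B -> I (A `|` B)].

Definition positive (I : set (set nat)) : set (set nat) :=
  [set A | infinite_set A /\ ~ I A].

Definition nsubsets (A : set nat) (n : nat) : set {fset nat} :=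
  [set s | [set` s] `<=` A /\ #|` s| = n].

(* A function with domain [A]^n is represented throughout by a total function
   on {fset nat} of which only the values on [nsubsets A n] are used. *)

Definition ramsey (I : set (set nat)) : Prop :=
  forall (A : set nat) (pi : {fset nat} -> bool), positive I A ->
  exists H : set nat, [/\ positive I H, H `<=` A &
    exists c : bool, forall s, nsubsets H 2 s -> pi s = c].

(* The shift between sets of equal size: remove m = min s and add some x above
   max s. Merely asking s \ {min s} to be an initial segment of t would, on
   singletons, relate everything to everything instead of giving <. *)
Definition shift (s t : {fset nat}) : Prop :=
  exists m x : nat,
    [/\ m \in s, forall y, y \in s -> (m <= y)%N,
        forall y, y \in s -> (y < x)%N &
        t = (x |` (s `\ m))%fset].

Definition shift_on (A : set nat) (n : nat) (s t : {fset nat}) : Prop :=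
  [/\ nsubsets A n s, nsubsets A n t & shift s t].

Definition shift_trans (A : set nat) (n : nat) :
    {fset nat} -> {fset nat} -> Prop :=
  clos_trans {fset nat} (shift_on A n).

Definition monotone_on (R : realType) (A : set nat) (n : nat)
    (f : {fset nat} -> R) : Prop :=
  (forall s t, nsubsets A n s -> nsubsets A n t ->
     shift_trans A n s t -> f s <= f t) \/
  (forall s t, nsubsets A n s -> nsubsets A n t ->
     shift_trans A n s t -> f t <= f s).

Definition h_Mon (R : realType) (I : set (set nat)) (n : nat) : Prop :=
  forall (A : set nat) (f : {fset nat} -> R), positive I A ->
  exists B : set nat, [/\ positive I B, B `<=` A & monotone_on B n f].

(* Main.v *)
Require Import Defs.
From Stdlib Require Import Relation_Operators.
From mathcomp Require Import all_boot all_order all_algebra.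
From mathcomp Require Import finmap zify.
From mathcomp Require Import all_classical all_reals.

(** The implication from h-Mon to Ramsey only uses exponent 2.  View a
    colouring of pairs as a 0/1-valued function f and make it monotone on a
    positive set B.  If {a, b} with a < b has the larger value then so does
    every {c, d} with b < c < d, because {a, b}, {b, c}, {c, d} is a chain of
    shifts.  Hence f is constant on B or on B minus a finite set, which is
    still positive ([ramsey_of_h_Mon2]).

    Conversely, monotonicity on n-sets is homogeneity on (n+1)-sets: s and its
    shift t are the two extreme n-subsets of the (n+1)-set s U t, so a set that
    is homogeneous for the colouring telling whether f s <= f t is one on which
    f is monotone ([h_Mon_of_homogeneous]).  What remains is to raise the
    exponent of the partition relation from 2 to every n >= 1
    ([ramsey_homogeneous]).

    The induction step works inside a positive set A and a colouring pi of
    (n+1)-sets.  The sets s being countably many, the traces pi (s U {x})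
    place each x at a point of the Cantor space.  Comparing points
    lexicographically colours pairs, and on a positive homogeneous set the
    points form a lexicographically monotone sequence; such a sequence
    converges, i.e. for each s the value pi (s U {x}) is eventually constant
    in x ([convergent_subset]).  A second colouring of pairs makes the set so
    sparse that this value is already reached at the first element of the set
    above s ([sparse_subset]).  Now the colour of an (n+1)-set no longer
    depends on its largest element, and the statement for n applies. *)

Set Implicit Arguments.
Unset Strict Implicit.
Unset Printing Implicit Defensive.
Import Order.TTheory GRing.Theory Num.Theory.
Local Open Scope classical_set_scope.
Local Open Scope ring_scope.
Local Open Scope nat_scope.

(** The partition relation I^+ -> (I^+)^n_2; at exponent 2 it is convertible to
    [ramsey I]. *)
Definition homogeneous (I : set (set nat)) (n : nat) : Prop :=
  forall (A : set nat) (pi : {fset nat} -> bool), positive I A ->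
  exists H : set nat, [/\ positive I H, H `<=` A &
    exists c : bool, forall s, nsubsets H n s -> pi s = c].

(** * Finite sets of natural numbers and positive sets *)

Lemma infinite_above (A : set nat) (N : nat) :
  infinite_set A -> exists2 x, A x & N <= x.
Proof.
move=> infA; apply: contrapT => noA; apply: infA.
apply: (sub_finite_set _ (finite_II N)) => x Ax /=.
by rewrite ltnNge; apply/negP => Nx; apply: noA; exists x.
Qed.

Lemma fset_nat_max (s : {fset nat}) : s != fset0 ->
  exists2 m, m \in s & forall y, y \in s -> y <= m.
Proof.
move=> /fset0Pn exs.
have bound y : y \in s -> y <= \max_(x <- s) x.
  by move=> ys; apply: leq_bigmax_seq.
by case: (ex_maxnP exs bound) => m ms mmax; exists m.
Qed.

Lemma nsubsetsS_max (A : set nat) (n : nat) (t : {fset nat}) :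
  nsubsets A n.+1 t ->
  exists y s, [/\ A y, nsubsets A n s, forall u, u \in s -> u < y &
                  t = (y |` s)%fset].
Proof.
move=> [tA tn].
have t0 : t != fset0 by rewrite -cardfs_gt0 tn.
have [y yt ymax] := fset_nat_max t0.
exists y, (t `\ y)%fset; split.
- exact: tA.
- split; first by move=> u /=; rewrite in_fsetD1 => /andP[_ /tA].
  by move: tn; rewrite (cardfsD1 y) yt => -[].
- by move=> u; rewrite in_fsetD1 => /andP[uy /ymax]; rewrite ltn_neqAle uy.
- by rewrite fsetD1K.
Qed.

Lemma nsubsets1P (A : set nat) (s : {fset nat}) :
  nsubsets A 1 s -> exists2 a, A a & s = [fset a]%fset.
Proof.
move=> /nsubsetsS_max[a [s0 [Aa [_ /eqP]]]].
by rewrite cardfs_eq0 => /eqP -> _ ->; exists a => //; rewrite fsetU0.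
Qed.

Lemma nsubsets2P (A : set nat) (s : {fset nat}) :
  nsubsets A 2 s -> exists a b, [/\ A a, A b, a < b & s = [fset a; b]%fset].
Proof.
move=> /nsubsetsS_max[b [s1 [Ab /nsubsets1P[a Aa ->] ltb ->]]].
by exists a, b; split; rewrite 1?fsetUC ?ltb ?inE.
Qed.

Lemma nsubsets2 (A : set nat) (a b : nat) :
  A a -> A b -> a < b -> nsubsets A 2 [fset a; b]%fset.
Proof.
move=> Aa Ab ab; split; first by move=> x /=; rewrite !inE => /orP[]/eqP->.
by rewrite cardfs2 neq_ltn ab.
Qed.

Lemma fset2_inj (a b x y : nat) : a < b -> x < y ->
  [fset a; b]%fset = [fset x; y]%fset -> a = x /\ b = y.
Proof.
move=> ab xy /fsetP e.
by move: (e a) (e b) (e x) (e y); rewrite !inE !eqxx /=; lia.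
Qed.

Lemma positive_above (I : set (set nat)) (A : set nat) (N : nat) :
  is_ideal I -> positive I A -> positive I [set x | A x /\ N < x].
Proof.
move=> [Ifin _ Isub IU] [_ nIA].
have nI : ~ I [set x | A x /\ N < x].
  move=> IT; apply: nIA; apply: (Isub _ ([set x | A x /\ N < x] `|` `I_N.+1)).
    by move=> x Ax; have [xN|Nx] := leqP x N; [right|left].
  by apply: IU => //; apply/Ifin/finite_II.
by split=> // fin; apply/nI/Ifin.
Qed.

(** * From monotone functions to homogeneous sets *)

Lemma shift_pair (B : set nat) (a b c : nat) :
  B a -> B b -> B c -> a < b -> b < c ->
  shift_on B 2 [fset a; b]%fset [fset b; c]%fset.
Proof.
move=> Ba Bb Bc ab bc; split; [exact: nsubsets2|exact: nsubsets2|].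
exists a, c; split.
- by rewrite !inE eqxx.
- by move=> y; rewrite !inE => /orP[]/eqP->; lia.
- by move=> y; rewrite !inE => /orP[]/eqP->; lia.
- by apply/fsetP => y; rewrite !inE; lia.
Qed.

(** Both alternatives in the definition of monotonicity say, for a 0/1-valued
    function, that one of the two values is inherited along shifts. *)
Lemma ramsey_of_h_Mon2 (R : realType) (I : set (set nat)) :
  is_ideal I -> h_Mon R I 2 -> ramsey I.
Proof.
move=> hI mon A pi posA.
have [B [posB BA monB]] := mon A (fun s => (pi s)%:R%R) posA.
have [c cB] : exists c, forall s t, nsubsets B 2 s -> nsubsets B 2 t ->
    shift_trans B 2 s t -> pi s = c -> pi t = c.
  case: monB => h; [exists true|exists false] => s t Bs Bt st;
    move: (h s t Bs Bt st);
    by rewrite ler_nat; case: (pi s); case: (pi t).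
have [[s [Bs pis]]|none] := pselect (exists s, nsubsets B 2 s /\ pi s = c).
  have [a [b [Ba Bb ab sE]]] := nsubsets2P Bs.
  exists [set x | B x /\ b < x]; split; first exact: positive_above.
    by move=> x [/BA].
  exists c => t /nsubsets2P[x [y [[Bx bx] [By _] xy tE]]].
  apply: (cB s) => //; first by rewrite tE; apply: nsubsets2.
  rewrite sE tE; apply: (@t_trans _ _ _ [fset b; x]%fset);
    by apply: t_step; apply: shift_pair.
exists B; split=> //; exists (~~ c) => s Bs.
have : pi s <> c by move=> e; apply: none; exists s.
by case: (pi s); case: (c).
Qed.

(** * Raising the exponent of the partition relation *)

Lemma ramsey_rel (I : set (set nat)) (A : set nat) (r : nat -> nat -> bool) :
  ramsey I -> positive I A ->
  exists H : set nat, [/\ positive I H, H `<=` A &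
    exists c : bool, forall x y, H x -> H y -> x < y -> r x y = c].
Proof.
move=> ram posA.
pose pi s := `[< exists x y, [/\ x < y, s = [fset x; y]%fset & r x y] >].
have [H [posH HA [c Hc]]] := ram A pi posA.
exists H; split=> //; exists c => x y Hx Hy xy.
rewrite -(Hc _ (nsubsets2 Hx Hy xy)); apply/idP/asboolP.
  by move=> rxy; exists x, y.
by move=> [x' [y' [xy' /(fset2_inj xy xy')[-> ->]]]].
Qed.

Lemma monotone_bool_cvg (H : set nat) (N : nat) (b : nat -> bool) :
  (forall x y, H x -> H y -> N <= x -> x < y -> b x -> b y) ->
  exists M, forall x y, H x -> H y -> M <= x -> M <= y -> b x = b y.
Proof.
move=> mon.
have [[z [Hz Nz bz]]|none] := pselect (exists z, [/\ H z, N <= z & b z]).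
  have bH x : H x -> z <= x -> b x.
    by move=> Hx; rewrite leq_eqVlt => /orP[/eqP<-//|/(mon z)]; apply.
  by exists z => x y Hx Hy zx zy; rewrite !bH.
have bH x : H x -> N <= x -> b x = false.
  by move=> Hx Nx; apply/negP => bx; apply: none; exists x.
by exists N => x y Hx Hy Nx Ny; rewrite !bH.
Qed.

(** Sequential compactness of the Cantor space, along positive sets.  On a set
    homogeneous for the strict lexicographic order, once the coordinates
    before i have stabilised the i-th one is monotone, so it stabilises too. *)
Lemma convergent_subset (I : set (set nat)) (A : set nat)
    (phi : nat -> nat -> bool) :
  ramsey I -> positive I A ->
  exists H : set nat, [/\ positive I H, H `<=` A &
    forall i, exists N, forall x y, H x -> H y -> N <= x -> N <= y ->
      phi x i = phi y i].
Proof.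
move=> ram posA.
pose lex x y := `[< exists i, [/\ forall j, j < i -> phi x j = phi y j,
                                  ~~ phi x i & phi y i] >].
have [H [posH HA [c Hc]]] := ramsey_rel lex ram posA.
exists H; split=> //.
suff cvg i : exists N, forall x y, H x -> H y -> N <= x -> N <= y ->
    forall j, j < i -> phi x j = phi y j.
  move=> i; have [N NP] := cvg i.+1; exists N => x y Hx Hy Nx Ny.
  exact: (NP x y).
elim: i => [|i [N NP]]; first by exists 0.
have [M MP] : exists M, forall x y, H x -> H y -> M <= x -> M <= y ->
    phi x i = phi y i.
  case: c Hc => Hc.
    apply: (@monotone_bool_cvg H N) => x y Hx Hy Nx xy phix.
    have eqxy := NP x y Hx Hy Nx (leq_trans Nx (ltnW xy)).
    have /asboolP[k [eqk phixk phiyk]] := Hc x y Hx Hy xy.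
    have [ki|ik|ki] := ltngtP k i.
    - by move: phixk; rewrite eqxy // phiyk.
    - by rewrite -eqk.
    - by move: phixk; rewrite ki phix.
  have [M MP] : exists M, forall x y, H x -> H y -> M <= x -> M <= y ->
      ~~ phi x i = ~~ phi y i.
    apply: (@monotone_bool_cvg H N) => x y Hx Hy Nx xy phix.
    have eqxy := NP x y Hx Hy Nx (leq_trans Nx (ltnW xy)).
    apply/negP => phiy; move/negbT/asboolP: (Hc x y Hx Hy xy); apply.
    by exists i.
  by exists M => x y Hx Hy Mx My; apply: negb_inj; apply: MP.
exists (maxn N M) => x y Hx Hy; rewrite !geq_max => /andP[Nx Mx] /andP[Ny My] j.
by rewrite ltnS leq_eqVlt => /orP[/eqP->|]; [apply: MP|apply: NP].
Qed.

(** There are only finitely many [s] with all elements at most [x], so the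
    relation [h s <= y for all such s] holds for all large [y] and therefore
    cannot fail on all pairs of an infinite set. *)
Lemma sparse_subset (I : set (set nat)) (A : set nat) (h : {fset nat} -> nat) :
  ramsey I -> positive I A ->
  exists H : set nat, [/\ positive I H, H `<=` A &
    forall x y s, H x -> H y -> x < y -> (forall u, u \in s -> u <= x) ->
      h s <= y].
Proof.
move=> ram posA.
pose r x y := `[< forall s : {fset nat},
  (forall u, u \in s -> u <= x) -> h s <= y >].
have [H [posH HA [c Hc]]] := ramsey_rel r ram posA.
exists H; split=> // x y s Hx Hy xy sx.
suff cT : c = true by move: (Hc x y Hx Hy xy); rewrite cT => /asboolP; apply.
pose initial := [fset u in iota 0 x.+1]%fset.
pose M := \max_(t <- fpowerset initial) h t.
have [z Hz] := infinite_above (maxn M x.+1) posH.1.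
rewrite geq_max => /andP[Mz xz]; rewrite -(Hc x z) //.
apply/asboolP => t tx; apply: leq_trans Mz; apply: leq_bigmax_seq => //.
rewrite fpowersetE; apply/fsubsetP => u /tx ux.
by rewrite !inE mem_iota; lia.
Qed.

Lemma homogeneous1 (I : set (set nat)) : is_ideal I -> homogeneous I 1.
Proof.
move=> [Ifin _ Isub IU] A pi [_ nIA].
pose P c := [set x | A x /\ pi [fset x]%fset = c].
have [c nIP] : exists c, ~ I (P c).
  apply: contrapT => allI; apply: nIA.
  apply: (Isub _ (P true `|` P false)).
    by move=> x Ax; case e: (pi [fset x]%fset); [left|right].
  by apply: IU; apply: contrapT => nI; apply: allI; eexists; apply: nI.
exists (P c); split.
- by split=> // fin; apply/nIP/Ifin.
- by move=> x [].
- by exists c => s /nsubsets1P[x [_ pix] ->].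
Qed.

(** After convergence and sparsification, [pi (y |` s)] equals the limit colour
    [lim s] as soon as [y] lies above [s].  Sparseness compares [y] with an
    element of the set below it, namely max [s]: this is where [s] has to be
    nonempty, and why the induction starts at exponent 1. *)
Lemma homogeneousS (I : set (set nat)) (n : nat) :
  ramsey I -> homogeneous I n.+1 -> homogeneous I n.+2.
Proof.
move=> ram IH A pi posA.
(* The coordinates are indexed by codes of finite sets; a number that codes
   no set contributes a constant coordinate. *)
pose phi x i :=
  if choice.unpickle i is Some s then pi (x |` s)%fset else false.
have [B [posB BA Bcvg]] := convergent_subset phi ram posA.
have /choice[h hP] : forall s : {fset nat}, exists N, forall x y,
    B x -> B y -> N <= x -> N <= y -> pi (x |` s)%fset = pi (y |` s)%fset.
  by move=> s; have [N] := Bcvg (choice.pickle s); rewrite /phi choice.pickleK; exists N.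
have [C [posC CB Csparse]] := sparse_subset h ram posB.
pose lim s := `[< exists x, [/\ B x, h s <= x & pi (x |` s)%fset] >].
have [H [posH HC [c Hc]]] := IH C lim posC.
exists H; split=> //; first by move=> x /HC/CB/BA.
exists c => t /nsubsetsS_max[y [s [Hy Hs ltsy ->]]].
rewrite -(Hc s Hs); have [sH sn] := Hs.
have [m ms mmax] : exists2 m, m \in s & forall u, u \in s -> u <= m.
  by apply: fset_nat_max; rewrite -cardfs_gt0 sn.
have hy : h s <= y.
  by apply: (Csparse m) => //; [apply: HC; apply: sH|apply: HC|apply: ltsy].
have By : B y by apply/CB/HC.
apply/idP/asboolP; first by move=> piy; exists y.
by move=> [x [Bx hx pix]]; rewrite (hP s y x).
Qed.

Lemma ramsey_homogeneous (I : set (set nat)) (n : nat) :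
  is_ideal I -> ramsey I -> homogeneous I n.+1.
Proof.
move=> hI ram; elim: n => [|n IH]; first exact: homogeneous1.
exact: homogeneousS.
Qed.

(** * From homogeneous sets to monotone functions *)

Lemma shift_union (s t : {fset nat}) : shift s t ->
  exists m x, [/\ m \in s, forall y, y \in s -> m <= y,
    forall y, y \in s -> y < x, t = (x |` (s `\ m))%fset &
    (s `|` t = x |` s)%fset].
Proof.
move=> [m [x [ms mmin xmax tE]]]; exists m, x; split=> //.
apply/fsetP => u; rewrite tE !inE.
case: (u =P m) => [->|_]; rewrite ?ms /= ?orbT //.
by case: (u \in s); rewrite ?orbT ?orbF.
Qed.

(** [s] and [t] are the union without its maximum and without its minimum. *)
Lemma shift_union_inj (s t s' t' : {fset nat}) :
  shift s t -> shift s' t' -> (s `|` t = s' `|` t')%fset -> s = s' /\ t = t'.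
Proof.
move=> /shift_union[m [x [ms mmin xmax -> ->]]].
move=> /shift_union[m' [x' [ms' mmin' xmax' -> ->]]] /fsetP e.
have xx' : x = x'.
  move: (e x) (e x'); rewrite !inE !eqxx /= => /esym/orP[/eqP//|/xmax' h1].
  by move=> /orP[/eqP//|/xmax h2]; lia.
subst x'.
have ss' : s = s'.
  apply/fsetP => u; move: (e u); rewrite !inE; case: (u =P x) => [->|//] _.
  by apply/idP/idP => [/xmax|/xmax']; rewrite ltnn.
subst s'; split=> //; suff -> : m = m' by [].
by apply/eqP; rewrite eqn_leq mmin ?mmin'.
Qed.

Lemma h_Mon_of_homogeneous (R : realType) (I : set (set nat)) (n : nat) :
  homogeneous I n.+1 -> h_Mon R I n.
Proof.
move=> hom A f posA.
pose pi u := `[< exists s t,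
  [/\ shift s t, u = (s `|` t)%fset & (f s <= f t)%R] >].
have [B [posB BA [c Bc]]] := hom A pi posA.
exists B; split=> //.
have step s t : shift_on B n s t -> (f s <= f t)%R = c.
  move=> [[sB sn] [tB _] st].
  have <- : pi (s `|` t)%fset = c.
    apply: Bc; split.
      by move=> u /=; rewrite inE => /orP[/sB|/tB].
    have [m [x [_ _ xmax _ ->]]] := shift_union st.
    rewrite cardfsU1 sn; case: (boolP (x \in s)) => [/xmax|//].
    by rewrite ltnn.
  apply/idP/asboolP; first by move=> fst; exists s, t.
  by move=> [s' [t' [st' /(shift_union_inj st st')[-> ->]]]].
case: c Bc step => _ step; [left|right] => s t _ _.
- elim=> {s t} [s t /step//|s u t _ h1 _ h2].
  exact: le_trans h1 h2.
- elim=> {s t} [s t /step|s u t _ h1 _ h2]; last exact: le_trans h2 h1.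
  by move=> /negbT; rewrite -ltNge => /ltW.
Qed.

Theorem proposition3p25 (R : realType) (I : set (set nat)) (hI : is_ideal I) :
  ramsey I <-> (forall n : nat, (1 <= n)%N -> h_Mon R I n).
Proof.
split=> [ram n _|mon].
  exact/h_Mon_of_homogeneous/ramsey_homogeneous.
exact: (ramsey_of_h_Mon2 hI (mon 2 isT)).
Qed.
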